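(* Let $\Delta$ be a set of routing policies considered by the seller, and for $\rho\in\Delta$ let $x_i(\rho)$ be the total allocation to buyer $i$ under $\rho$, given the realized demand of all buyers. If, for perturbed bids $\tilde b$, the seller implements an optimal routing policy in $\Delta$, i.e. an element of $$\operatorname{argmax}_{\rho\in\Delta}\ \sum_i \tilde b_i\,x_i(\rho),$$ then the implied allocation rule (mapping perturbed bids and realized demand to total allocations) is ex post monotone, and the resulting mechanism (the BKS mechanism with this allocation rule) is truthful-in-expectation for buyers.
   Context: There are $n$ buyers; buyer $i$ has a constant value $v_i\ge0$ per byte. The realized demand of the buyers is $d=(d_1,\dots,d_n)$. The set $\Delta$ is fixed (independent of the bids), and $x_i(\rho)$ depends only on the policy $\rho$ and on the realized demand, not on the bids; the seller is assumed able to predict realized demand perfectly. An allocation rule $\mathcal A$ assigns to a bid vector $b'$ and realized demand $d$ the total traffic $\mathcal A_i(b',d)$ of each buyer $i$. It is ex post monotone if $\mathcal A_i(b'',d)\ge\mathcal A_i(b',d)$ for all $i$, all bid vectors $b'$, all $d$, and all $b''$ that differ from $b'$ only in coordinate $i$ with $b_i''>b_i'$. BKS mechanism with allocation rule $\mathcal A$, parameter $\mu\in(0,1)$ and reserve $r\ge0$: each buyer $i$ submits a bid $b_i\ge r$; independently for each $i$, with probability $1-\mu$ the perturbed bid is $\tilde b_i=b_i$, otherwise $\tilde b_i=r+(b_i-r)\gamma^{1/(1-\mu)}$ with $\gamma$ uniform on $[0,1]$. The allocation is $x=\mathcal A(\tilde b,d)$. Buyer $i$ pays $b_ix_i-R_i$,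 with rebate $R_i=\frac1\mu x_i(b_i-r)$ if $\tilde b_i<b_i$ and $R_i=0$ otherwise. A mechanism is truthful-in-expectation if a risk-neutral buyer (utility $v_i x_i$ minus payment) maximizes expected utility by bidding truthfully, whatever the bids of others, the expectation being over the random coin flips of the mechanism. (Since bids must be at least $r$, this concerns buyers with $v_i\ge r$.)
   Formalization: For truthfulness, the implied allocation rule is additionally assumed Borel measurable in the bids for each realized demand; with arbitrary tie-breaking among optimal policies the expected utility need not exist. *)

(* Defs.v *)
From HB Require Import structures.
From mathcomp Require Import all_boot all_order all_algebra.
From mathcomp Require Import all_classical all_reals all_analysis.

Set Implicit Arguments.
Unset Strict Implicit.
Unset Printing Implicit Defensive.

Import Order.TTheory GRing.Theory Num.Theory.

Local Open Scope classical_set_scope.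
Local Open Scope ring_scope.

(* Bids below the reserve are not allowed, so a bid vector has all its
   coordinates at least [r]; for [r = 0] these are all nonnegative vectors. *)
Definition bid_vectors (R : realType) (n : nat) (r : R) : set (n.-tuple R) :=
  [set b | forall i, r <= tnth b i].

Definition set_bid (R : realType) (n : nat) (b : n.-tuple R) (i : 'I_n) (t : R)
  : n.-tuple R := [tuple if j == i then t else tnth b j | j < n].

(* [A b d i] is the total traffic of buyer [i] at bids [b] and realized demand
   [d]. *)
Definition allocation_rule (R : realType) (D : Type) (n : nat) : Type :=
  n.-tuple R -> n.-tuple D -> 'I_n -> R.

Definition ex_post_monotone (R : realType) (D : Type) (n : nat) (r : R)
    (A : allocation_rule R D n) : Prop :=
  forall (i : 'I_n) (b' b'' : n.-tuple R) (d : n.-tuple D),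
    bid_vectors r b' -> bid_vectors r b'' ->
    (forall j, j != i -> tnth b'' j = tnth b' j) ->
    tnth b' i < tnth b'' i ->
    A b' d i <= A b'' d i.

(* A randomized mechanism: [T] is the sample space of its coin flips. *)
Record mechanism (R : realType) (D : Type) (n : nat) (T : Type) := Mechanism {
  allocation : n.-tuple R -> n.-tuple D -> T -> 'I_n -> R ;
  payment : n.-tuple R -> n.-tuple D -> T -> 'I_n -> R }.

Definition utility (R : realType) (D : Type) (n : nat) (T : Type)
    (M : mechanism R D n T) (i : 'I_n) (v : R)
    (b : n.-tuple R) (d : n.-tuple D) (w : T) : R :=
  v * allocation M b d w i - payment M b d w i.

(* Buyer [i] has value [v]; coordinate [i] of [b] is an arbitrary deviation,
   the other coordinates are the bids of the others. Integrability says that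
   the expected utilities being compared exist, the library's integral being
   total. *)
Definition truthful_in_expectation (R : realType) (D : Type) (n : nat)
    (dT : measure_display) (T : measurableType dT) (P : probability T R) (r : R)
    (M : mechanism R D n T) : Prop :=
  forall (i : 'I_n) (v : R) (b : n.-tuple R) (d : n.-tuple D),
    r <= v -> bid_vectors r b ->
    P.-integrable setT (EFin \o utility M i v b d) /\
    ('E_P[utility M i v b d] <= 'E_P[utility M i v (set_bid b i v) d])%E.

Definition perturbed_bid (R : realType) (mu r beta : R) (resampled : bool)
    (gamma : R) : R :=
  if resampled then r + (beta - r) * gamma `^ (1 / (1 - mu)) else beta.

Section BKS.
Variables (R : realType) (D : Type) (n : nat) (T : Type).
(* [c i] tells whether the bid of buyer [i] is resampled, using [g i]. *)
Variables (mu r : R) (c : 'I_n -> T -> bool) (g : 'I_n -> T -> R).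
Variable A : allocation_rule R D n.

Definition perturbed_bids (b : n.-tuple R) (w : T) : n.-tuple R :=
  [tuple perturbed_bid mu r (tnth b i) (c i w) (g i w) | i < n].

Definition bks_allocation (b : n.-tuple R) (d : n.-tuple D) (w : T) (i : 'I_n)
  : R := A (perturbed_bids b w) d i.

Definition bks_rebate (b : n.-tuple R) (d : n.-tuple D) (w : T) (i : 'I_n)
  : R :=
  if tnth (perturbed_bids b w) i < tnth b i
  then 1 / mu * bks_allocation b d w i * (tnth b i - r) else 0.

Definition bks_payment (b : n.-tuple R) (d : n.-tuple D) (w : T) (i : 'I_n)
  : R := tnth b i * bks_allocation b d w i - bks_rebate b d w i.

Definition bks_mechanism : mechanism R D n T :=
  Mechanism bks_allocation bks_payment.

End BKS.

(* The [2 n] coin flips are mutually independent; the product rule for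
   subfamilies is the case where the other sets are [setT]. *)
Definition bks_coins (R : realType) (n : nat) (dT : measure_display)
    (T : measurableType dT) (P : probability T R) (mu : R)
    (c : 'I_n -> {RV P >-> bool}) (g : 'I_n -> {RV P >-> R}) : Prop :=
  [/\ forall i, P (c i @^-1` [set true]) = mu%:E,
      forall i (U : set R), measurable U ->
        distribution P (g i) U = uniform_prob (@ltr01 R) U
    & forall (B : 'I_n -> set bool) (U : 'I_n -> set R),
        (forall i, measurable (U i)) ->
        P (\bigcap_i (c i @^-1` B i `&` g i @^-1` U i)) =
        (\prod_(i < n) (P (c i @^-1` B i) * P (g i @^-1` U i)))%E].

Definition argmax (R : realType) (S : Type) (Delta : set S) (f : S -> R)
  : set S :=
  [set rho | Delta rho /\ forall rho', Delta rho' -> f rho' <= f rho].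

(* The rule induced by a seller choosing policy [policy b d] at bids [b] and
   realized demand [d]; [x rho d i] is the total allocation to buyer [i] under
   [rho]. *)
Definition implied_rule (R : realType) (D S : Type) (n : nat)
    (x : S -> n.-tuple D -> 'I_n -> R)
    (policy : n.-tuple R -> n.-tuple D -> S) : allocation_rule R D n :=
  fun b d i => x (policy b d) d i.

(* Main.v *)
(** A buyer with own bid [t] gets, in expectation over the other coins, [F t] if
    the bid is kept and [G t] if it is resampled; up to null events the expected
    utility is
      [(v - t) * ((1 - mu) * F t + mu * G t) + (t - r) * G t].
    Since [gamma] is uniform, for [r <= s <= t] and
    [p = ((s - r) / (t - r)) `^ (1 - mu)], conditioning on [gamma <= p] turns the
    resampled bid from [t] into the resampled bid from [s], while on [gamma > p]
    the bid lies between [s] and [t].  With monotonicity this gives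
      [p * G s + (1 - p) * F s <= G t <= p * G s + (1 - p) * F t],
    and truthfulness follows from weighted AM-GM for the powers of
    [(s - r) / (t - r)], without computing Myerson's integral [\int F].
    Monotonicity of the implied rule is the usual exchange argument: add the two
    optimality inequalities. *)

Require Import Defs.
From HB Require Import structures.
From mathcomp Require Import all_boot all_order all_algebra.
From mathcomp Require Import all_classical all_reals all_analysis.
From mathcomp Require Import measurable_realfun ring lra.

Set Implicit Arguments.
Unset Strict Implicit.
Unset Printing Implicit Defensive.

Import Order.TTheory GRing.Theory Num.Theory numFieldNormedType.Exports.

Local Open Scope classical_set_scope.
Local Open Scope ring_scope.

(** * Real inequalities behind truthfulness *)

Lemma powR_weighted_AMGM (R : realType) (l th : R) : 0 <= l -> 0 < th < 1 ->
  l `^ th <= th * l + (1 - th).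
Proof.
move=> l0 /andP[th0 th1].
have th1' : 0 < 1 - th by rewrite subr_gt0.
(* Young's inequality for the [th]-th power of [l] and [1], with conjugate exponents [th^-1] and
   [(1 - th)^-1]. *)
have := @conjugate_powR R (l `^ th) 1 th^-1 (1 - th)^-1.
rewrite !invrK powR1 mulr1 mul1r -powRrM divff ?gt_eqF// powRr1// mulrC.
by apply=> //; rewrite ?powR_ge0 ?invr_gt0// subrKC.
Qed.

(** Underbidding: [V] and [s] are value and bid in excess of the reserve. With
    [m = (1 - mu) * s + mu * V] the left side equals [V * F - m * (F - G)], while the last
    hypothesis gives [V * Gv >= V * F - V * p * (F - G)]; so [V * p <= m] suffices. *)
Lemma bks_utility_le_upward (R : realFieldType) (mu V s p F G Gv : R) :
  0 < mu < 1 -> 0 <= s <= V -> V * p <= (1 - mu) * s + mu * V ->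
  G <= F -> p * G + (1 - p) * F <= Gv ->
  (V - s) * ((1 - mu) * F + mu * G) + s * G <= V * Gv.
Proof.
move=> /andP[mu0 mu1] /andP[s0 sV] pE GF Gv_ge.
have V0 : 0 <= V by lra.
have := ler_wpM2l V0 Gv_ge.
have : 0 <= ((1 - mu) * s + mu * V - V * p) * (F - G) by apply: mulr_ge0; lra.
nra.
Qed.

(** Overbidding, with [l] the ratio of value to bid in excess of the reserve. After division by [s]
    the claim reads [m * G <= l * Gv + (m - l) * F]; it is [l / p] times the upper bound on [G] plus
    [m - l / p] times [G <= F]. *)
Lemma bks_utility_le_downward (R : realFieldType) (mu V s l p F G Gv : R) :
  0 < mu < 1 -> 0 <= s -> V = l * s -> 0 <= l -> 0 <= p ->
  l <= p * (mu * l + (1 - mu)) ->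
  0 <= Gv -> G <= F -> G <= p * Gv + (1 - p) * F ->
  (V - s) * ((1 - mu) * F + mu * G) + s * G <= V * Gv.
Proof.
move=> /andP[mu0 mu1] s0 -> l0 p0 lp Gv0 GF Gle.
set m := mu * l + (1 - mu) in lp *.
suff H : m * G <= l * Gv + (1 - l) * (1 - mu) * F.
  have := ler_wpM2l s0 H; rewrite /m; nra.
(* For [p = 0] the bound on [l] forces [l = 0], and only [G <= F] remains to be used. *)
have [p00|pN0] := eqVneq p 0.
  have l00 : l = 0 by move: lp; rewrite p00 mul0r => ?; lra.
  by rewrite /m l00; nra.
have pp : 0 < p by rewrite lt_def pN0.
set k := l / p.
have lE : l = k * p by rewrite /k divfK.
have k0 : 0 <= k by rewrite divr_ge0.
(* This makes the second weight [m - k] nonnegative. *)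
have km : k <= m by rewrite ler_pdivrMr// mulrC.
have H1 := ler_wpM2l k0 Gle.
have H2 : 0 <= (m - k) * (F - G) by apply: mulr_ge0; lra.
have -> : (1 - l) * (1 - mu) = m - l by rewrite /m; ring.
rewrite [in l * _]lE [in m - l]lE; nra.
Qed.

(* [F t] and [G t] are the expected allocations of a buyer bidding [t] whose bid
   is kept, respectively resampled. *)
Lemma interim_utility_le (R : realType) (mu r : R) (F G : R -> R) :
  0 < mu < 1 ->
  (forall t, r <= t -> 0 <= G t) -> (forall t, r <= t -> G t <= F t) ->
  (forall s t, r <= s -> s <= t -> r < t ->
    let p := ((s - r) / (t - r)) `^ (1 - mu) in
    p * G s + (1 - p) * F s <= G t) ->
  (forall s t, r <= s -> s <= t -> r < t ->
    let p := ((s - r) / (t - r)) `^ (1 - mu) in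
    G t <= p * G s + (1 - p) * F t) ->
  forall v t, r <= v -> r <= t ->
  (v - t) * ((1 - mu) * F t + mu * G t) + (t - r) * G t <= (v - r) * G v.
Proof.
move=> mu01 G_ge0 G_le_F split_ge split_le v t rv rt.
case/andP: (mu01) => mu_gt0 mu_lt1.
have vtE : v - t = (v - r) - (t - r) by ring.
have mu01' : 0 < 1 - mu < 1 by rewrite subr_gt0 mu_lt1 gtrBl mu_gt0.
have [tv|vt] := leP t v.
  (* If [v = r] the ratio below would have denominator zero; but then [t = r] too and both sides
     vanish. *)
  have [e|vN] := eqVneq v r.
    have -> : t = v by apply/le_anti; rewrite tv e rt.
    by rewrite e !subrr !mul0r addr0.
  have rv' : r < v by rewrite lt_def vN.
  have V0 : 0 < v - r by rewrite subr_gt0.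
  rewrite vtE; apply: (@bks_utility_le_upward _ _ _ _
    (((t - r) / (v - r)) `^ (1 - mu))) => //.
  - by rewrite subr_ge0 rt lerB.
  - have := @powR_weighted_AMGM R ((t - r) / (v - r)) (1 - mu).
    rewrite divr_ge0 ?subr_ge0// => /(_ isT mu01') h.
    have := ler_wpM2l (ltW V0) h.
    by rewrite mulrDr mulrCA [(v - r) * (_ / _)]mulrC divfK ?gt_eqF//; lra.
  - exact: G_le_F.
  - exact: split_ge.
have rt' : r < t by exact: le_lt_trans vt.
have s0 : 0 < t - r by rewrite subr_gt0.
set l := (v - r) / (t - r).
have l0 : 0 <= l by rewrite divr_ge0 ?subr_ge0// ltW.
rewrite vtE; apply: (@bks_utility_le_downward _ _ _ _ l (l `^ (1 - mu))) => //.
- exact: ltW.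
- by rewrite divfK// gt_eqF.
- exact: powR_ge0.
(* Dividing out the power [1 - mu] of [l] leaves its power [mu], to which weighted AM-GM applies. *)
- have lE : l = l `^ (1 - mu) * l `^ mu.
    by rewrite -powRD ?subrK ?powRr1// oner_eq0.
  rewrite {1}lE ler_wpM2l ?powR_ge0//.
  exact: powR_weighted_AMGM.
- exact: G_ge0.
- exact: G_le_F.
- by apply: split_le => //; exact: ltW.
Qed.

(** * Scaling of Lebesgue measure and of the uniform law *)

Lemma lebesgue_measure_divr (R : realType) (p : R) (V : set R) : 0 < p ->
  measurable V ->
  lebesgue_measure ((fun x : R => x / p) @^-1` V) =
  (p%:E * lebesgue_measure V)%E.
Proof.
move=> p0 mV.
have mf : measurable_fun [set: measurableTypeR R]
    ((fun x : R => x / p) : _ -> measurableTypeR R).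
  exact: mulrr_measurable.
pose k : {nonneg R} := NngNum (ltW (eqbRL (invr_gt0 p) p0)).
have -> : lebesgue_measure V = pushforward (mscale k (@lebesgue_measure R))
    ((fun x : R => x / p) : _ -> measurableTypeR R) V.
  (* By uniqueness it is enough that the pushforward, scaled by [p^-1], gives every interval []a,
     b]] its length. *)
  apply: lebesgue_measure_unique => // _ [[a b]] _ <-.
  transitivity ((p^-1)%:E *
      lebesgue_measure ((fun x : R => x / p)%R @^-1` `]a, b]%classic))%E => //.
  have -> : (fun x : R => x / p) @^-1` `]a, b] = `]a * p, b * p]%classic.
    by apply/seteqP; split=> x /=; rewrite !in_itv/= ltr_pdivlMr// ler_pdivrMr.
  rewrite !lebesgue_measure_itv/= !lte_fin ltr_pM2r//.
  case: ifP => ab; last by rewrite mule0.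
  by rewrite -!EFinB -EFinM -mulrBl mulrC mulfK// gt_eqF.
by rewrite /pushforward /mscale/= muleA -EFinM mulfV ?gt_eqF// mul1e.
Qed.

(** Dropping the null point [0] gives a half-open interval, which splits as []0, p]] and []p,
    1]]. *)
Lemma uniform_prob01E (R : realType) (U : set R) : measurable U ->
  uniform_prob (@ltr01 R) U = lebesgue_measure (U `&` `]0, 1]%classic).
Proof.
move=> mU; rewrite /uniform_prob integral_uniform_pdf.
have UE : (U `&` `[0, 1]%classic) `\ 0 = U `&` `]0, 1]%classic.
  apply/seteqP; split=> x /=; rewrite !in_itv/=.
    by move=> [[Ux /andP[x0 x1]] /eqP xN0]; rewrite lt_def xN0 x0 x1.
  move=> [Ux /andP[x0 x1]]; rewrite x1 (ltW x0); split => //.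
  by apply/eqP; rewrite gt_eqF.
have mU1 : measurable (U `&` `]0, 1]%classic) by apply: measurableI.
rewrite -(@integral_setD1 _ _ 0) ?UE//; last first.
  apply/measurable_EFinP; apply: measurable_funTS; exact: measurable_uniform_pdf.
rewrite (eq_integral (cst 1%E)) ?integral_cst ?mul1e//.
move=> x /set_mem[_]/=; rewrite in_itv/= /uniform_pdf => /andP[x0 x1].
by rewrite x1 (ltW x0)/= subr0 invr1.
Qed.

(** A uniform variable conditioned to be at most [p] is, after division by [p], uniform again. *)
Lemma uniform_prob01_scale (R : realType) (p : R) (V : set R) : 0 <= p <= 1 ->
  measurable V ->
  uniform_prob (@ltr01 R) (`]0, p] `&` (fun x : R => x / p) @^-1` V) =
  (p%:E * uniform_prob (@ltr01 R) (`]0%R, 1%R] `&` V))%E.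
Proof.
move=> /andP[p0 p1] mV.
have [->|pN0] := eqVneq p 0.
  by rewrite set_itv_ge ?bnd_simp// set0I measure0 mul0e.
have pp : 0 < p by rewrite lt_def pN0.
have mV1 : measurable (`]0%R, 1%R] `&` V) by apply: measurableI.
have mpre : measurable (`]0, p] `&` (fun x : R => x / p) @^-1` V).
  apply: measurableI => //.
  have mf : measurable_fun setT (fun x : R => x / p) by exact: mulrr_measurable.
  by rewrite -[X in measurable X]setTI; exact: mf.
rewrite !uniform_prob01E// [in RHS]setIAC setIid -lebesgue_measure_divr//.
congr (lebesgue_measure _); apply/seteqP; split=> x /=; rewrite !in_itv/=.
  move=> [[/andP[x0 xp] Vx] _].
  by rewrite divr_gt0// ler_pdivrMr// mul1r xp.
rewrite ler_pdivrMr// mul1r pmulr_lgt0 ?invr_gt0// => -[/andP[x0 xp] Vx].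
by rewrite x0 xp (le_trans xp).
Qed.

(** * Equality of integrals from agreement on a pi-system *)

Lemma ge0_integral_mrestr d (T : measurableType d) (R : realType)
    (m : {measure set T -> \bar R}) (E : set T) (mE : measurable E)
    (f : T -> \bar R) : measurable_fun setT f -> (forall x, 0 <= f x)%E ->
  (\int[mrestr m mE]_x f x = \int[m]_(x in E) f x)%E.
Proof.
move=> mf f0; rewrite -(setUv E) ge0_integral_setU//; last 3 first.
  - exact: measurableC.
  - exact: measurable_funTS.
  - by rewrite disj_set2E setICr.
rewrite [X in (_ + X)%E](_ : _ = 0%E) ?adde0; last first.
  apply: null_set_integral; [exact: measurableC|exact: measurable_funTS|].
  by rewrite /= /mrestr setICl measure0.
by apply: eq_measure_integral => A mA AE; rewrite /= /mrestr setIidl.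
Qed.

(** The law of [phi] restricted to [E] and [k] times the law of [phi'] restricted to [E'] are finite
    measures that agree on the pi-system [G], hence equal; both integrals are then integrals of [h]
    by change of variables. *)
Lemma ge0_integral_pi_system d d' (T : measurableType d)
    (Y : measurableType d') (R : realType) (P : probability T R)
    (G : set (set Y)) (E E' : set T) (phi phi' : T -> Y) (k : R)
    (h : Y -> \bar R) :
  measurable = <<s G >> -> setI_closed G -> G setT -> measurable E -> measurable E' ->
  measurable_fun setT phi -> measurable_fun setT phi' -> 0 <= k ->
  (forall A, G A -> P (E `&` phi @^-1` A) = k%:E * P (E' `&` phi' @^-1` A))%E ->
  measurable_fun setT h -> (forall y, 0 <= h y)%E ->
  (\int[P]_(x in E) h (phi x) = k%:E * \int[P]_(x in E') h (phi' x))%E.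
Proof.
move=> mG GI GT mE mE' mphi mphi' k0 PG mh h0.
pose kn := NngNum k0.
have key A : measurable A ->
    pushforward (mrestr P mE) phi A =
    pushforward (mscale kn (mrestr P mE')) phi' A.
  apply: (measure_unique G (fun=> setT)) => //.
  - by apply/seteqP; split=> // x _; exists 0%N.
  - move=> B GB.
    change (P (phi @^-1` B `&` E) = (k%:E * P (phi' @^-1` B `&` E'))%E).
    by rewrite setIC PG// setIC.
  - move=> _; change (P (phi @^-1` setT `&` E) < +oo)%E.
    by rewrite preimage_setT setTI (le_lt_trans (probability_le1 _ mE))// ltry.
have h0phi (f : T -> Y) x : (0 <= (h \o f) x)%E by exact: h0.
have mhphi (f : T -> Y) : measurable_fun setT f ->
    measurable_fun setT (h \o f) by move=> mf; exact: measurableT_comp.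
rewrite -[LHS](ge0_integral_mrestr P mE (mhphi _ mphi) (h0phi _)).
rewrite -(ge0_integral_mrestr P mE' (mhphi _ mphi') (h0phi _)).
rewrite -(ge0_integral_mscale _ measurableT kn (mhphi _ mphi')
  (fun x _ => h0phi _ x)).
have /esym e := @ge0_integral_pushforward _ _ _ _ _ _ mphi (mrestr P mE)
  setT h measurableT mh (fun y _ => h0 y).
have e' := @ge0_integral_pushforward _ _ _ _ _ _ mphi' (mscale kn (mrestr P mE'))
  setT h measurableT mh (fun y _ => h0 y).
rewrite !preimage_setT in e e'.
apply: etrans e (etrans _ e').
by apply: eq_measure_integral => A mA _; exact: key.
Qed.

(** * The measurable space of coin outcomes *)

Definition coin_rect {R : realType} {n : nat} (B : 'I_n -> set bool)
    (U : 'I_n -> set R) : set ('I_n -> bool * R) :=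
  [set y | forall j, B j (y j).1 /\ U j (y j).2].

(** The pi-system whose probabilities are given by the independence clause of [bks_coins]; the coin
    space carries the sigma-algebra it generates. *)
Definition coin_rects (R : realType) (n : nat) : set (set ('I_n -> bool * R)) :=
  [set A | exists B U, (forall j, measurable (U j)) /\ A = coin_rect B U].
Arguments coin_rects R n : clear implicits.

Notation coin_space R n := (g_sigma_algebraType (coin_rects R n)).

Lemma setI_closed_coin_rects R n : setI_closed (coin_rects R n).
Proof.
move=> _ _ [B [U [mU ->]]] [B' [U' [mU' ->]]].
exists (fun j => B j `&` B' j), (fun j => U j `&` U' j); split.
  by move=> j; apply: measurableI.
apply/seteqP; split=> y /=.
  by move=> [By By'] j; case: (By j); case: (By' j).
by move=> H; split=> j; case: (H j) => -[? ?] [? ?].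
Qed.

Lemma coin_rectsT R n : coin_rects R n setT.
Proof.
exists (fun=> setT), (fun=> setT); split => //.
by apply/seteqP; split.
Qed.

Lemma measurable_coin_fst {R n} (j : 'I_n) :
  measurable_fun [set: coin_space R n] (fun y => (y j).1).
Proof.
apply: (measurable_fun_bool true); rewrite setTI; apply: sub_sigma_algebra.
exists (fun k => if k == j then [set true] else setT), (fun=> setT); split => //.
apply/seteqP; split=> y /=.
  by move=> yj k; case: eqP => [->|].
by move=> /(_ j)[]; rewrite eqxx.
Qed.

Lemma measurable_coin_snd {R n} (j : 'I_n) :
  measurable_fun [set: coin_space R n] (fun y => (y j).2).
Proof.
move=> _ V mV; rewrite setTI; apply: sub_sigma_algebra.
exists (fun=> setT), (fun k => if k == j then V else setT); split.
  by move=> k; case: ifP.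
apply/seteqP; split=> y /=.
  by move=> yj k; case: eqP => [->|].
by move=> /(_ j)[]; rewrite eqxx.
Qed.

Lemma measurable_to_coin_space {R n} d (T : measurableType d)
    (f : T -> coin_space R n) :
  (forall j, measurable_fun setT (fun w => (f w j).1)) ->
  (forall j, measurable_fun setT (fun w => (f w j).2)) ->
  measurable_fun setT f.
Proof.
move=> m1 m2; apply: (@measurability _ _ T (coin_space R n) setT f (coin_rects R n)) => //.
move=> _ [_ [B [U [mU ->]]] <-]; rewrite setTI.
rewrite (_ : _ @^-1` _ = \bigcap_(j in [set: 'I_n])
    ((fun w => (f w j).1) @^-1` B j `&` (fun w => (f w j).2) @^-1` U j)); last first.
  by apply/seteqP; split=> w H j; [move=> _; exact: (H j)|exact: (H j I)].
apply: fin_bigcap_measurable => // j _; apply: measurableI.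
  by rewrite -[X in measurable X]setTI; exact: m1.
by rewrite -[X in measurable X]setTI; exact: m2.
Qed.

(** * Replacing the own coins of one buyer *)

Section Coins.
Context {R : realType} {n : nat} {d : measure_display} {T : measurableType d}.
Context {P : probability T R} {mu : R}.
Context {c : 'I_n -> {RV P >-> bool}} {g : 'I_n -> {RV P >-> R}}.
Hypothesis coins : bks_coins mu c g.
Implicit Types (i j : 'I_n) (X : T -> R) (U V : set R) (p : R).

(** A kept bid is encoded as a bid resampled with [X = 1], since every power of [1] is [1]. Kept,
    resampled and rescaled bids thus differ only in [X]. *)
Definition own_coin i X (w : T) : coin_space R n :=
  fun j => if j == i then (true, X w) else (c j w, g j w).

Lemma measurable_own_coin i X :
  measurable_fun setT X -> measurable_fun setT (own_coin i X).
Proof.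
move=> mX; apply: measurable_to_coin_space => j; rewrite /own_coin.
  by case: (j == i) => /=; [exact: measurable_cst|exact: measurable_funP].
by case: (j == i) => /=; [|exact: measurable_funP].
Qed.

Lemma coin_preimage_measurable i (B : set bool) U : measurable U ->
  measurable (c i @^-1` B `&` g i @^-1` U).
Proof.
by move=> mU; apply: measurableI; apply: measurable_funPTI.
Qed.

(** If [true] lies in [B i], the event is again a rectangle in the original coins, constrained at
    [i] by [B0] and by [U0] intersected with the preimage of [U i], so independence applies;
    otherwise it is empty. *)
Lemma own_coin_rect i (B0 : set bool) (U0 : set R) (phi : R -> R)
    (B : 'I_n -> set bool) (U : 'I_n -> set R) :
  measurable U0 -> measurable_fun setT phi -> (forall j, measurable (U j)) ->
  P ((c i @^-1` B0 `&` g i @^-1` U0) `&`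
     own_coin i (phi \o g i) @^-1` coin_rect B U) =
  ((P (c i @^-1` B0) * P (g i @^-1` (U0 `&` phi @^-1` U i))) *
   if `[< B i true >] then
     \prod_(j < n | j != i) (P (c j @^-1` B j) * P (g j @^-1` U j)) else 0)%E.
Proof.
move=> mU0 mphi mU; case: coins => _ _ indep.
case: asboolP => [Bi|nBi]; last first.
  rewrite mule0 (_ : _ `&` _ = set0) ?measure0//.
  by apply/seteqP; split=> w //= [_] /(_ i); rewrite /own_coin eqxx => -[].
pose B1 j := if j == i then B0 else B j.
pose U1 j := if j == i then U0 `&` phi @^-1` U i else U j.
have mU1 j : measurable (U1 j).
  rewrite /U1; case: ifP => // _; apply: measurableI => //.
  by rewrite -[X in measurable X]setTI; exact: mphi.
rewrite (_ : _ `&` _ = \bigcap_j (c j @^-1` B1 j `&` g j @^-1` U1 j)).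
  rewrite indep// (bigD1 i)//= /B1 /U1 eqxx; congr (_ * _)%E.
  by apply: eq_bigr => j /negPf ->.
apply/seteqP; split=> w.
  move=> [[Bw Uw] H] j _; rewrite /B1 /U1 /=.
  move: (H j); rewrite /own_coin/=; case: eqP => [->|//] /=.
  by case.
move=> H; split.
  by move: (H i I); rewrite /B1 /U1 eqxx => -[? []].
move=> j; move: (H j I); rewrite /B1 /U1 /own_coin/=.
by case: eqP => [->|//] -[? []].
Qed.

(** The coins of the other buyers contribute the same factor on both sides, so an identity for the
    coins of [i] alone extends to all integrands. *)
Lemma integral_own_coin_eq i (B B' : set bool) (U U' : set R)
    (phi phi' : R -> R) (k : R) (h : coin_space R n -> \bar R) :
  measurable U -> measurable U' ->
  measurable_fun setT phi -> measurable_fun setT phi' -> 0 <= k ->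
  (forall V, measurable V ->
    P (c i @^-1` B) * P (g i @^-1` (U `&` phi @^-1` V)) =
    k%:E * (P (c i @^-1` B') * P (g i @^-1` (U' `&` phi' @^-1` V))))%E ->
  measurable_fun setT h -> (forall y, 0 <= h y)%E ->
  (\int[P]_(w in c i @^-1` B `&` g i @^-1` U) h (own_coin i (phi \o g i) w) =
   k%:E * \int[P]_(w in c i @^-1` B' `&` g i @^-1` U')
            h (own_coin i (phi' \o g i) w))%E.
Proof.
move=> mU mU' mphi mphi' k0 H mh h0.
apply: (@ge0_integral_pi_system _ _ T (coin_space R n) R P (coin_rects R n) _ _
  (own_coin i (phi \o g i)) (own_coin i (phi' \o g i)) k h) => //.
- exact: setI_closed_coin_rects.
- exact: coin_rectsT.
- exact: coin_preimage_measurable.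
- exact: coin_preimage_measurable.
- by apply: measurable_own_coin; apply: measurableT_comp.
- by apply: measurable_own_coin; apply: measurableT_comp.
- move=> _ [B1 [U1 [mU1 ->]]].
  by rewrite !own_coin_rect// muleA -H.
Qed.

Lemma coin_unif i U : measurable U -> P (g i @^-1` U) = uniform_prob (@ltr01 R) U.
Proof. by case: coins => _ + _ => /(_ i U)/[apply]. Qed.

Lemma coin_itv i p : 0 <= p <= 1 -> P (g i @^-1` `]p, 1]) = (1 - p)%:E.
Proof.
move=> /andP[p0 p1]; rewrite coin_unif// uniform_prob01E// setIidl.
  rewrite lebesgue_measure_itv/= lte_fin; case: ltP => // p1'.
  by rewrite (@le_anti _ _ p 1) ?p1// subrr.
by move=> x /=; rewrite !in_itv/= => /andP[px ->]; rewrite (le_lt_trans p0).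
Qed.

Lemma coin_true i : P (c i @^-1` [set true]) = mu%:E.
Proof. by case: coins. Qed.

Lemma coin_false i : P (c i @^-1` [set false]) = (1 - mu)%:E.
Proof.
rewrite (_ : _ @^-1` _ = ~` (c i @^-1` [set true])); last first.
  by apply/seteqP; split=> w /=; case: (c i w).
by rewrite probability_setC ?coin_true//; exact: measurable_funPTI.
Qed.

(** A uniform variable avoids the endpoints almost surely, and there are finitely many buyers. The
    strict bound [g i w < 1] later puts a resampled bid strictly below any bid above the reserve. *)
Lemma coins_ae : {ae P, forall w, forall i, 0 < g i w < 1}.
Proof.
apply: filter_forall => i.
have mE : measurable (g i @^-1` `]0, 1[) by exact: measurable_funPTI.
exists (~` (g i @^-1` `]0, 1[)); split; first exact: measurableC.
  change (P (~` (g i @^-1` `]0%R, 1%R[)) = 0%E).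
  rewrite probability_setC// coin_unif// uniform_prob01E// setIidl.
    by rewrite lebesgue_measure_itv/= lte_fin ltr01 oppr0 adde0 subee.
  by move=> x /=; rewrite !in_itv/= => /andP[-> /ltW ->].
by move=> w /=; rewrite in_itv.
Qed.

Section OwnCoinIntegrals.
Variables (i : 'I_n) (h : coin_space R n -> \bar R).
Hypotheses (mh : measurable_fun setT h) (h0 : forall y, (0 <= h y)%E).

Let mhX X : measurable_fun setT X -> measurable_fun setT (h \o own_coin i X).
Proof. by move=> mX; apply: measurableT_comp => //; exact: measurable_own_coin. Qed.

(** The integrand does not see the coins of [i], so restricting to an event on [c i] only multiplies
    by its probability. *)
Lemma integral_kept : 0 <= mu <= 1 ->
  (\int[P]_(w in c i @^-1` [set false]) h (own_coin i (cst 1%R) w) =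
   (1 - mu)%:E * \int[P]_w h (own_coin i (cst 1%R) w))%E.
Proof.
move=> /andP[mu0 mu1].
have := @integral_own_coin_eq i [set false] setT setT setT (cst 1) (cst 1)
  (1 - mu) h.
rewrite !preimage_setT !setIT; apply => //; first by rewrite subr_ge0.
by move=> V _; rewrite coin_false probability_setT mul1e.
Qed.

Lemma integral_resampled : 0 <= mu ->
  (\int[P]_(w in c i @^-1` [set true]) h (own_coin i (g i) w) =
   mu%:E * \int[P]_w h (own_coin i (g i) w))%E.
Proof.
move=> mu0.
have := @integral_own_coin_eq i [set true] setT setT setT id id mu h.
rewrite !preimage_setT !setIT; apply => //.
by move=> V _; rewrite coin_true probability_setT mul1e.
Qed.

Lemma integral_own_coin01 X : measurable_fun setT X ->
  (\int[P]_(w in g i @^-1` `]0%R, 1%R]) h (own_coin i X w) =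
   \int[P]_w h (own_coin i X w))%E.
Proof.
move=> mX; have mE : measurable (g i @^-1` `]0%R, 1%R]) by exact: measurable_funPTI.
rewrite -[in RHS](setUv (g i @^-1` `]0%R, 1%R])) ge0_integral_setU//.
- rewrite [X in (_ + X)%E](_ : _ = 0%E) ?adde0//.
  apply: null_set_integral; [exact: measurableC|exact: measurable_funTS (mhX _)|].
  change (P (~` (g i @^-1` `]0%R, 1%R])) = 0%E).
  by rewrite probability_setC ?coin_itv ?lexx ?ler01// ?subr0 ?subee.
- exact: measurableC.
- by rewrite setUv; exact: mhX.
- by rewrite disj_set2E setICr.
Qed.

(** On [g i <= p] the variable [g i / p] is again uniform, and independence leaves the other coins
    unaffected. *)
Lemma integral_scaled p : 0 <= p <= 1 ->
  (\int[P]_(w in g i @^-1` `]0%R, p]) h (own_coin i (fun w => g i w / p)%R w) =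
   p%:E * \int[P]_w h (own_coin i (g i) w))%E.
Proof.
move=> p01; rewrite -[X in (_ * X)%E]integral_own_coin01; last exact: measurable_funP.
have := @integral_own_coin_eq i setT setT `]0, p] `]0, 1] (fun x => x / p) id p h.
rewrite !preimage_setT !setTI; apply => //.
- exact: mulrr_measurable.
- by case/andP: p01.
- move=> V mV; rewrite probability_setT !mul1e !coin_unif//.
  + by rewrite uniform_prob01_scale.
  + by apply: measurableI.
  + apply: measurableI => //.
    by rewrite -[X in measurable X]setTI; exact: mulrr_measurable.
Qed.

Lemma integral_top p : 0 <= p <= 1 ->
  (\int[P]_(w in g i @^-1` `]p, 1%R]) h (own_coin i (cst 1%R) w) =
   (1 - p)%:E * \int[P]_w h (own_coin i (cst 1%R) w))%E.
Proof.
move=> p01.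
have := @integral_own_coin_eq i setT setT `]p, 1] setT (cst 1) (cst 1) (1 - p) h.
rewrite !preimage_setT !setTI; apply => //.
  by case/andP: p01; rewrite subr_ge0.
move=> V mV; rewrite preimage_cst; case: ifP => _.
  by rewrite setIT setTI coin_itv// preimage_setT !probability_setT mul1e !mule1.
by rewrite !setI0 preimage_set0 measure0 !mule0.
Qed.

End OwnCoinIntegrals.
End Coins.

(** * Finite extended reals and bid vectors *)

Lemma fine_combinationE (R : realType) (p k : R) (x y : \bar R) :
  x \is a fin_num -> y \is a fin_num ->
  (p%:E * x + k%:E * y = (p * fine x + k * fine y)%:E)%E.
Proof. by case: x y => [x| |] [y| |]. Qed.

Lemma fine_combination_le (R : realType) (p k : R) (x y z : \bar R) :
  x \is a fin_num -> y \is a fin_num -> z \is a fin_num ->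
  (z <= p%:E * x + k%:E * y)%E -> fine z <= p * fine x + k * fine y.
Proof. by move=> fx fy fz; rewrite fine_combinationE// -{1}(fineK fz). Qed.

Lemma fine_combination_ge (R : realType) (p k : R) (x y z : \bar R) :
  x \is a fin_num -> y \is a fin_num -> z \is a fin_num ->
  (p%:E * x + k%:E * y <= z)%E -> p * fine x + k * fine y <= fine z.
Proof. by move=> fx fy fz; rewrite fine_combinationE// -{1}(fineK fz). Qed.

Lemma tnth_set_bid (R : realType) n (b : n.-tuple R) i t j :
  tnth (set_bid b i t) j = if j == i then t else tnth b j.
Proof. by rewrite /set_bid tnth_mktuple. Qed.

Lemma set_bid_same (R : realType) n (b : n.-tuple R) i :
  set_bid b i (tnth b i) = b.
Proof.
by apply: eq_from_tnth => j; rewrite tnth_set_bid; case: eqP => [->|].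
Qed.

Lemma set_bid_set_bid (R : realType) n (b : n.-tuple R) i s t :
  set_bid (set_bid b i s) i t = set_bid b i t.
Proof. by apply: eq_from_tnth => j; rewrite !tnth_set_bid; case: eqP. Qed.

Lemma bid_vectors_set_bid (R : realType) n (b : n.-tuple R) t r :
  bid_vectors r b -> r <= t -> forall i, bid_vectors r (set_bid b i t).
Proof. by move=> rb rt i j; rewrite tnth_set_bid; case: ifP. Qed.

Lemma measurable_bid_vectors (R : realType) n (r : R) :
  measurable (@bid_vectors R n r).
Proof.
rewrite (_ : bid_vectors r = \bigcap_(j in [set: 'I_n])
    ((fun b => tnth b j) @^-1` `[r, +oo[)).
  apply: fin_bigcap_measurable => // j _.
  by rewrite -[X in measurable X]setTI; exact: measurable_tnth.
apply/seteqP; split=> b H j; first by move=> _ /=; rewrite in_itv/= andbT; exact: H.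
by move: (H j I); rewrite /= in_itv/= andbT.
Qed.

(** * Bounds and measurability of perturbed bids *)

Lemma perturbed_bid_ge_reserve (R : realType) (mu r beta : R) e x :
  r <= beta -> r <= perturbed_bid mu r beta e x.
Proof.
move=> rb; rewrite /perturbed_bid; case: e => //.
by rewrite lerDl mulr_ge0 ?powR_ge0// subr_ge0.
Qed.

Lemma perturbed_bid_le (R : realType) (mu r beta : R) e x : mu < 1 ->
  r <= beta -> 0 <= x <= 1 -> perturbed_bid mu r beta e x <= beta.
Proof.
move=> mu1 rb /andP[x0 x1]; rewrite /perturbed_bid; case: e => //.
rewrite -lerBrDl ler_piMr ?subr_ge0//.
apply: (@le_trans _ _ (1 `^ (1 / (1 - mu)))); last by rewrite powR1.
rewrite ge0_ler_powR ?nnegrE//.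
by rewrite divr_ge0// subr_ge0 ltW.
Qed.

Section Perturb.
Context {R : realType} {n : nat}.
Variables (mu r : R).

(** The perturbed bids as a function of the coin outcome instead of the sample point, so that the
    coins of one buyer can be replaced by [own_coin]. *)
Definition perturb (b : n.-tuple R) (y : coin_space R n) : n.-tuple R :=
  [tuple perturbed_bid mu r (tnth b j) (y j).1 (y j).2 | j < n].

Lemma bid_vectors_perturb b y : bid_vectors r b -> bid_vectors r (perturb b y).
Proof. by move=> rb j; rewrite tnth_mktuple; exact: perturbed_bid_ge_reserve. Qed.

Lemma measurable_perturb b : measurable_fun setT (perturb b).
Proof.
apply/measurable_fun_tnthP => j.
rewrite (_ : _ \o _ = (fun y => if (y j).1
    then r + (tnth b j - r) * (y j).2 `^ (1 / (1 - mu)) else tnth b j)); last first.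
  by apply/funext => y; rewrite /= tnth_mktuple.
apply: measurable_fun_ifT => //; first exact: measurable_coin_fst.
apply: measurable_funD => //; apply: measurable_funM => //.
exact: (measurableT_comp (measurable_powR _) (measurable_coin_snd j)).
Qed.

End Perturb.

(** * Truthfulness for monotone, nonnegative, measurable rules bounded below each bid vector *)

Section BksTruthful.
Context {R : realType} {D : Type} {n : nat} {dT : measure_display}.
Context {T : measurableType dT} {P : probability T R} {mu r : R}.
Context {c : 'I_n -> {RV P >-> bool}} {g : 'I_n -> {RV P >-> R}}.
Hypotheses (mu_gt0 : 0 < mu) (mu_lt1 : mu < 1) (coins : bks_coins mu c g).
Variable A : allocation_rule R D n.
Hypothesis A_mono : ex_post_monotone r A.
Hypothesis A_ge0 : forall b d i, bid_vectors r b -> 0 <= A b d i.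
Hypothesis A_bounded : forall b d i, bid_vectors r b -> exists C,
  forall b', bid_vectors r b' -> (forall j, tnth b' j <= tnth b j) ->
  A b' d i <= C.
Hypothesis A_measurable : forall d i,
  measurable_fun (bid_vectors r) (fun b : n.-tuple R => A b d i).

Let q := 1 / (1 - mu).

Let mu01 : 0 < mu < 1. Proof. by rewrite mu_gt0. Qed.

Let powRK (x : R) : 0 <= x -> (x `^ (1 - mu)) `^ q = x.
Proof.
by move=> x0; rewrite -powRrM /q mul1r divff ?powRr1// subr_eq0 gt_eqF.
Qed.

Lemma allocation_le b' b'' d i : bid_vectors r b' -> bid_vectors r b'' ->
  (forall j, j != i -> tnth b'' j = tnth b' j) -> tnth b' i <= tnth b'' i ->
  A b' d i <= A b'' d i.
Proof.
move=> rb' rb'' off; rewrite le_eqVlt => /predU1P[e|]; last exact: A_mono.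
suff -> : b' = b'' by [].
by apply: eq_from_tnth => j; case: (eqVneq j i) => [->//|/off].
Qed.

Section Buyer.
Variables (i : 'I_n) (b : n.-tuple R) (d : n.-tuple D).
Hypothesis rb : bid_vectors r b.

Let H t (y : coin_space R n) : \bar R :=
  (A (perturb mu r (set_bid b i t) y) d i)%:E.

Let rset t : r <= t -> bid_vectors r (set_bid b i t).
Proof. by move=> rt; exact: bid_vectors_set_bid. Qed.

Let H_ge0 t : r <= t -> forall y, (0 <= H t y)%E.
Proof.
by move=> rt y; rewrite lee_fin A_ge0//; exact: bid_vectors_perturb (rset rt).
Qed.

Let measurable_H t : r <= t -> measurable_fun setT (H t).
Proof.
move=> rt; apply/measurable_EFinP.
apply: (@measurable_comp _ _ _ _ _ _ (bid_vectors r)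
  (fun b' : n.-tuple R => A b' d i)) => //.
- exact: measurable_bid_vectors.
- by move=> _ [y _ <-]; exact: bid_vectors_perturb (rset rt).
- exact: measurable_perturb.
Qed.

(** The two perturbed vectors agree off [i], and the coordinate [i] is [r] plus the quantity
    compared in the hypothesis; monotonicity of [A] does the rest. *)
Let H_le t t' (X X' : T -> R) w : r <= t -> r <= t' ->
  (t - r) * X w `^ q <= (t' - r) * X' w `^ q ->
  (H t (own_coin (c := c) (g := g) i X w) <=
   H t' (own_coin (c := c) (g := g) i X' w))%E.
Proof.
move=> rt rt' le; rewrite lee_fin; apply: allocation_le.
- exact: bid_vectors_perturb (rset rt).
- exact: bid_vectors_perturb (rset rt').
- by move=> j ji; rewrite !tnth_mktuple /own_coin !(negPf ji).
- by rewrite !tnth_mktuple /own_coin !eqxx /perturbed_bid lerD2l.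
Qed.

Let F t := (\int[P]_w H t (own_coin (c := c) (g := g) i (cst 1%R) w))%E.
Let G t := (\int[P]_w H t (own_coin (c := c) (g := g) i (g i) w))%E.

Let mH t X : r <= t -> measurable_fun setT X ->
  measurable_fun setT (fun w => H t (own_coin (c := c) (g := g) i X w)).
Proof.
by move=> rt mX; exact: measurableT_comp (measurable_H rt) (measurable_own_coin _ mX).
Qed.

Let mg : measurable_fun setT (g i). Proof. exact: measurable_funP. Qed.

Let m1 : measurable_fun setT (cst 1 : T -> R). Proof. exact: measurable_cst. Qed.

(** Almost surely no perturbed bid exceeds the original one, so [A_bounded] at the unperturbed
    vector bounds the integrand. *)
Let F_lty t : r <= t -> (F t < +oo)%E.
Proof.
move=> rt; have [C HC] := A_bounded d i (rset rt).
(* The maximum with [0] makes the majorant visibly nonnegative, as the comparison of integrals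
   asks. *)
apply: (@le_lt_trans _ _ (\int[P]_w (cst (Num.max C 0)%:E w))%E); last first.
  by rewrite integral_cst// (_ : _ [set: T] = 1%E) ?mule1 ?ltry//; exact: probability_setT.
apply: ae_ge0_le_integral => //.
- by move=> w _; exact: H_ge0.
- exact: mH.
- by move=> w _; rewrite lee_fin le_max lexx orbT.
apply: filterS (coins_ae coins) => w g01 _.
rewrite lee_fin le_max HC//; first exact: bid_vectors_perturb (rset rt).
move=> j; rewrite tnth_mktuple; apply: perturbed_bid_le => //; first exact: rset.
rewrite /own_coin; case: ifP => _ /=; first by rewrite ler01 lexx.
by case/andP: (g01 j) => /ltW -> /ltW ->.
Qed.

Let powq_le (x y : R) : 0 <= x -> x <= y -> x `^ q <= y `^ q.
Proof.
move=> x0 xy; rewrite ge0_ler_powR ?nnegrE//; last exact: le_trans xy.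
by rewrite /q divr_ge0// subr_ge0 ltW.
Qed.

Let onepowq : 1 `^ q = 1 :> R. Proof. by rewrite powR1. Qed.

Let G_le_F t : r <= t -> (G t <= F t)%E.
Proof.
move=> rt; apply: ae_ge0_le_integral => //; try exact: mH.
- by move=> w _; exact: H_ge0.
- by move=> w _; exact: H_ge0.
apply: filterS (coins_ae coins) => w /(_ i)/andP[g0 g1] _.
apply: H_le => //; rewrite ler_wpM2l ?subr_ge0//.
by apply: powq_le; exact: ltW.
Qed.

Let F_ge0 t : r <= t -> (0 <= F t)%E.
Proof. by move=> rt; apply: integral_ge0 => w _; exact: H_ge0. Qed.

Let G_ge0 t : r <= t -> (0 <= G t)%E.
Proof. by move=> rt; apply: integral_ge0 => w _; exact: H_ge0. Qed.

Let F_fin t : r <= t -> F t \is a fin_num.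
Proof. by move=> rt; rewrite ge0_fin_numE ?F_lty ?F_ge0. Qed.

Let G_fin t : r <= t -> G t \is a fin_num.
Proof.
move=> rt; rewrite ge0_fin_numE ?G_ge0//.
exact: le_lt_trans (G_le_F rt) (F_lty rt).
Qed.

Let fineG_le_F t : r <= t -> fine (G t) <= fine (F t).
Proof. by move=> rt; exact: fine_le (G_fin rt) (F_fin rt) (G_le_F rt). Qed.

Section Split.
Variables (s t : R).
Hypotheses (rs : r <= s) (st : s <= t) (rt' : r < t).
Let rt : r <= t. Proof. exact: ltW. Qed.
Let l := (s - r) / (t - r).
Let p := l `^ (1 - mu).

Let l_ge0 : 0 <= l. Proof. by rewrite divr_ge0// subr_ge0. Qed.

Let p01 : 0 <= p <= 1.
Proof.
rewrite powR_ge0/=; apply: (@le_trans _ _ (1 `^ (1 - mu))); last by rewrite powR1.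
rewrite ge0_ler_powR ?nnegrE//.
  by rewrite subr_ge0 ltW.
by rewrite ler_pdivrMr ?subr_gt0// mul1r lerB.
Qed.

(** The choice of [p]: the coin value [p] perturbs the bid [t] exactly to [s]. *)
Let lE : (t - r) * p `^ q = s - r.
Proof. by rewrite powRK// mulrC divfK// subr_eq0 gt_eqF. Qed.

(* On [0 < g <= p] the bid perturbed from [t] is the one perturbed from [s] with
   the uniform variable [g / p]. *)
Let lower : (\int[P]_(w in g i @^-1` `]0%R, p]) H t (own_coin (c := c) (g := g) i (g i) w) =
  p%:E * G s)%E.
Proof.
rewrite -(integral_scaled coins i (measurable_H rs) (H_ge0 rs) p01).
apply: eq_integral => w /set_mem/=; rewrite in_itv/= => /andP[g0 gp].
have p0 : 0 < p by exact: lt_le_trans gp.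
have e : (t - r) * g i w `^ q = (s - r) * (g i w / p) `^ q.
  rewrite -lE -mulrA -powRM ?divr_ge0 ?ltW//.
  by rewrite mulrC [p * _]mulrC divfK ?gt_eqF// mulrC.
by apply/le_anti/andP; split; apply: H_le => //; rewrite e.
Qed.

Let splitE : G t = (p%:E * G s +
  \int[P]_(w in g i @^-1` `]p, 1%R]) H t (own_coin (c := c) (g := g) i (g i) w))%E.
Proof.
case/andP: p01 => p0 p1.
rewrite -lower /G -(integral_own_coin01 coins i (measurable_H rt) (H_ge0 rt) mg).
rewrite -ge0_integral_setU//.
- congr (integral P _ _); apply/seteqP; split=> w /=; rewrite !in_itv/=.
    move=> /andP[g0 g1]; rewrite g0 g1 andbT; case: leP => ?; [by left|by right].
  case=> /andP[]; first by move=> -> /le_trans ->.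
  by move=> pg ->; rewrite (le_lt_trans p0 pg).
- exact: measurable_funPTI.
- exact: measurable_funPTI.
- exact: measurable_funTS (mH rt mg).
- by move=> w _; exact: H_ge0.
- rewrite disj_set2E; apply/eqP/seteqP; split=> w //= [].
  by rewrite !in_itv/= => /andP[_ gp] /andP[/lt_geF]; rewrite gp.
Qed.

(** On [g i > p] the bid perturbed from [t] is at least [s], so the allocation is at least that of a
    kept bid [s]. *)
Lemma split_ge : p * fine (G s) + (1 - p) * fine (F s) <= fine (G t).
Proof.
apply: (fine_combination_ge (G_fin rs) (F_fin rs) (G_fin rt)).
rewrite [leRHS]splitE leeD2l//.
rewrite -(integral_top coins i (measurable_H rs) (H_ge0 rs) p01).
apply: ge0_le_integral => //.
- exact: measurable_funPTI.
- by move=> w _; exact: H_ge0.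
- exact: measurable_funTS (mH rs m1).
- exact: measurable_funTS (mH rt mg).
move=> w /=; rewrite in_itv/= => /andP[pg g1]; apply: H_le => //.
rewrite onepowq mulr1 -lE ler_wpM2l ?subr_ge0//; apply: powq_le; last exact: ltW.
by case/andP: p01.
Qed.

(** On [g i > p] the bid perturbed from [t] is at most [t], so the allocation is at most that of a
    kept bid [t]. *)
Lemma split_le : fine (G t) <= p * fine (G s) + (1 - p) * fine (F t).
Proof.
apply: (fine_combination_le (G_fin rs) (F_fin rt) (G_fin rt)).
rewrite [leLHS]splitE leeD2l//.
rewrite -(integral_top coins i (measurable_H rt) (H_ge0 rt) p01).
apply: ge0_le_integral => //.
- exact: measurable_funPTI.
- by move=> w _; exact: H_ge0.
- exact: measurable_funTS (mH rt mg).
- exact: measurable_funTS (mH rt m1).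
move=> w /=; rewrite in_itv/= => /andP[pg g1]; apply: H_le => //.
rewrite ler_wpM2l ?subr_ge0//; apply: powq_le => //.
by case/andP: p01 => p0 _; rewrite (le_trans p0)// ltW.
Qed.

End Split.

Lemma expected_utility_le v t : r <= v -> r <= t ->
  (v - t) * ((1 - mu) * fine (F t) + mu * fine (G t)) + (t - r) * fine (G t) <=
  (v - r) * fine (G v).
Proof.
apply: (interim_utility_le mu01 (F := fun t => fine (F t))
  (G := fun t => fine (G t))).
- by move=> s rs; rewrite fine_ge0// G_ge0.
- exact: fineG_le_F.
- exact: split_ge.
- exact: split_le.
Qed.

Let alloc (w : T) : R := bks_allocation mu r c g A b d w i.
Let t := tnth b i.

Let rt : r <= t. Proof. exact: rb. Qed.

Let bids_measurable : measurable_fun setT (perturbed_bids mu r c g b).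
Proof.
rewrite (_ : perturbed_bids mu r c g b =
    perturb mu r b \o (fun w => (fun j => (c j w, g j w)) : coin_space R n)).
  apply: measurableT_comp; first exact: measurable_perturb.
  by apply: measurable_to_coin_space => j /=; exact: measurable_funP.
apply/funext => w; apply: eq_from_tnth => j.
by rewrite /perturb/= !tnth_mktuple.
Qed.

Let perturbed_bids_in w : bid_vectors r (perturbed_bids mu r c g b w).
Proof. by move=> j; rewrite tnth_mktuple; exact: perturbed_bid_ge_reserve. Qed.

Let alloc_ge0 w : 0 <= alloc w. Proof. exact: A_ge0. Qed.

Let alloc_measurable : measurable_fun setT alloc.
Proof.
apply: (@measurable_comp _ _ _ _ _ _ (bid_vectors r)
  (fun b' : n.-tuple R => A b' d i)) => //.
- exact: measurable_bid_vectors.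
- by move=> _ [w _ <-]; exact: perturbed_bids_in.
Qed.

Let alloc_kept w : c i w = false ->
  (alloc w)%:E = H t (own_coin (c := c) (g := g) i (cst 1%R) w).
Proof.
move=> cw; rewrite /H set_bid_same /alloc /bks_allocation.
congr (A _ _ _)%:E; apply: eq_from_tnth => j; rewrite !tnth_mktuple /own_coin.
case: eqP => [->|//]; rewrite cw /perturbed_bid.
by rewrite -/q onepowq mulr1 subrKC.
Qed.

Let alloc_resampled w : c i w = true ->
  (alloc w)%:E = H t (own_coin (c := c) (g := g) i (g i) w).
Proof.
move=> cw; rewrite /H set_bid_same /alloc /bks_allocation.
congr (A _ _ _)%:E; apply: eq_from_tnth => j; rewrite !tnth_mktuple /own_coin.
by case: eqP => [->|//]; rewrite cw.
Qed.

Let mtrue : measurable (c i @^-1` [set true]). Proof. exact: measurable_funPTI. Qed.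

Let int_alloc_true :
  (\int[P]_(w in c i @^-1` [set true]) (alloc w)%:E = mu%:E * G t)%E.
Proof.
rewrite -(integral_resampled coins i (measurable_H rt) (H_ge0 rt) (ltW mu_gt0)).
by apply: eq_integral => w /set_mem; exact: alloc_resampled.
Qed.

Let int_alloc : (\int[P]_w (alloc w)%:E =
  ((1 - mu) * fine (F t) + mu * fine (G t))%:E)%E.
Proof.
have <- : c i @^-1` [set false] `|` c i @^-1` [set true] = setT.
  by apply/seteqP; split=> w //= _; case: (c i w); [right|left].
rewrite ge0_integral_setU//.
- apply: etrans (fine_combinationE (1 - mu) mu (F_fin rt) (G_fin rt)).
  congr (_ + _)%E; last exact: int_alloc_true.
  rewrite -(integral_kept coins i (measurable_H rt) (H_ge0 rt)).
    by apply: eq_integral => w /set_mem; exact: alloc_kept.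
  by rewrite !ltW.
- exact: measurable_funPTI.
- by apply: measurable_funTS; apply/measurable_EFinP.
- by move=> w _; rewrite lee_fin.
- by rewrite disj_set2E; apply/eqP/seteqP; split=> w //= [->].
Qed.

Let alloc_integrable : P.-integrable setT (EFin \o alloc).
Proof.
apply/integrableP; split; first exact/measurable_EFinP.
rewrite (eq_integral (fun w => (alloc w)%:E)) ?int_alloc ?ltry//.
by move=> w _; rewrite /= ger0_norm.
Qed.

Let rebate := bks_rebate mu r c g A b d ^~ i.

Let rebate_measurable : measurable_fun setT rebate.
Proof.
apply: measurable_fun_ifT => //.
  apply: measurable_fun_ltr => //.
  exact: measurableT_comp (measurable_tnth i) bids_measurable.
by apply: measurable_funM => //; apply: measurable_funM.
Qed.

Let utilityE v : utility (bks_mechanism mu r c g A) i v b d =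
  (fun w => (v - t) * alloc w + rebate w).
Proof.
by apply/funext => w; rewrite /utility/= /bks_payment -/t -/(alloc w) -/(rebate w); ring.
Qed.

Let k := (t - r) / mu.
Let k_ge0 : 0 <= k. Proof. by apply: divr_ge0; [rewrite subr_ge0|exact: ltW]. Qed.

(** The rebate is either [0] or [k * alloc], so the latter dominates it. *)
Let rebate_integrable : P.-integrable setT (EFin \o rebate).
Proof.
apply: (@le_integrable _ _ _ P setT _ _ (EFin \o (fun w => k * alloc w))) => //.
- exact/measurable_EFinP.
- move=> w _; have ka0 : 0 <= k * alloc w by exact: mulr_ge0.
  rewrite lee_fin (ger0_norm ka0) /rebate /bks_rebate.
  case: ifP => _; last by rewrite normr0.
  rewrite -/t -/(alloc w) [X in `|X|](_ : _ = k * alloc w) ?(ger0_norm ka0)//.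
  by rewrite /k mul1r [LHS]mulrC mulrA.
- by have := integrableZl measurableT k alloc_integrable.
Qed.

(* The rebate is paid when [tilde b_i < b_i]: up to null events this is
   resampling, unless [b_i = r], where the rebate vanishes anyway. *)
Let rebateE : {ae P, forall w, rebate w =
  k * (alloc w * \1_(c i @^-1` [set true]) w)}.
Proof.
apply: filterS (coins_ae coins) => w /(_ i)/andP[g0 g1].
have gq1 : g i w `^ q < 1.
  rewrite -[ltRHS]onepowq gt0_ltr_powR ?nnegrE ?ler01//; last exact: ltW.
  by rewrite /q divr_gt0// subr_gt0.
rewrite /rebate /bks_rebate -/(alloc w) -/t tnth_mktuple /perturbed_bid -/t -/q.
rewrite indicE (_ : (w \in _) = c i w); last by apply/idP/idP => /[!inE].
rewrite /k; case: (c i w); last by rewrite ltxx !mulr0.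
rewrite mulr1; have [rlt|] := ltP r t.
  rewrite ifT; first by rewrite mul1r [LHS]mulrC mulrA.
  by rewrite -ltrBrDl -[ltRHS]mulr1 ltr_pM2l// subr_gt0.
move=> tr; have -> : t = r by apply/le_anti; rewrite tr rt.
by rewrite subrr !(mulr0, mul0r) addr0 if_same.
Qed.

(** The factor [1 / mu] of the rebate cancels the probability [mu] of resampling. *)
Let int_rebate : (\int[P]_w (rebate w)%:E = ((t - r) * fine (G t))%:E)%E.
Proof.
rewrite (ae_eq_integral
    (fun w => (k * (alloc w * \1_(c i @^-1` [set true]) w))%:E)) //.
- rewrite (eq_integral (fun w => k%:E * (alloc w * \1_(c i @^-1` [set true]) w)%:E)%E).
    rewrite ge0_integralZl//.
    + rewrite (eq_integral
        ((fun w => (alloc w)%:E) \_ (c i @^-1` [set true]))) -?integral_mkcond.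
        rewrite [X in (_ * X)%E]int_alloc_true muleA -EFinM [k * mu]divfK ?gt_eqF//.
        by rewrite [RHS]EFinM (fineK (G_fin rt)).
      move=> w _; rewrite patchE indicE.
      by case: ifP => _; rewrite ?mulr1// mulr0.
    + by apply/measurable_EFinP; apply: measurable_funM.
    + by move=> w _; rewrite lee_fin mulr_ge0.
  by move=> w _; rewrite EFinM.
- exact/measurable_EFinP.
- by apply/measurable_EFinP; apply: measurable_funM => //; apply: measurable_funM.
- by apply: filterS rebateE => w -> _.
Qed.

Lemma bks_utility_integrable v :
  P.-integrable setT (EFin \o utility (bks_mechanism mu r c g A) i v b d).
Proof.
rewrite utilityE.
have := integrableD measurableT (integrableZl measurableT (v - t) alloc_integrable)
  rebate_integrable.
by apply: eq_integrable.
Qed.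

Lemma bks_expected_utility v :
  ('E_P[utility (bks_mechanism mu r c g A) i v b d] =
   ((v - t) * ((1 - mu) * fine (F t) + mu * fine (G t)) +
    (t - r) * fine (G t))%:E)%E.
Proof.
rewrite unlock utilityE EFinD EFinM -int_alloc -int_rebate.
rewrite -integralZl//.
have := integralD_EFin measurableT (integrableZl measurableT (v - t) alloc_integrable)
  rebate_integrable.
by [].
Qed.

End Buyer.

Lemma bks_truthful :
  truthful_in_expectation P r (bks_mechanism mu r c g A).
Proof.
move=> i v b d rv rb; split; first exact: bks_utility_integrable.
have rbv := bid_vectors_set_bid rb rv i.
rewrite (bks_expected_utility i d rb) (bks_expected_utility i d rbv).
(* At the truthful bid the first term carries the factor [v - v], so only [(v - r)] times the
   resampled allocation is left. *)
rewrite lee_fin tnth_set_bid eqxx subrr mul0r add0r set_bid_set_bid.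
exact: expected_utility_le.
Qed.

End BksTruthful.

(** * The rule implied by an optimal policy *)

Section ImpliedRule.
Context {R : realType} {n : nat} {D S : Type} {Delta : set S}.
Context {x : S -> n.-tuple D -> 'I_n -> R} {r : R}.
Context {policy : n.-tuple R -> n.-tuple D -> S}.
Hypothesis policy_opt : forall b d, bid_vectors r b ->
  argmax Delta (fun rho => \sum_(i < n) tnth b i * x rho d i) (policy b d).

Lemma implied_rule_monotone : ex_post_monotone r (implied_rule x policy).
Proof.
move=> i b' b'' d rb' rb'' off lt.
have [D' opt'] := policy_opt d rb'; have [D'' opt''] := policy_opt d rb''.
have := lerD (opt' _ D'') (opt'' _ D').
rewrite /implied_rule !(bigD1 i (P := xpredT))//=.
under [X in _ <= _ + (_ + X) -> _]eq_bigr => j ji do rewrite off//.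
under [X in _ + (_ + X) <= _ -> _]eq_bigr => j ji do rewrite off//.
(* The terms of the other buyers, whose bids agree, cancel in [h]; what remains is that the bid
   increase times the allocation increase of [i] is nonnegative. *)
move=> h; rewrite -subr_ge0 -(pmulr_rge0 _ (_ : 0 < tnth b'' i - tnth b' i)).
  by lra.
by rewrite subr_gt0.
Qed.

Hypothesis r_ge0 : 0 <= r.
Hypothesis x_ge0 : forall rho, Delta rho -> forall d i, 0 <= x rho d i.

Lemma implied_rule_ge0 b d i :
  bid_vectors r b -> 0 <= implied_rule x policy b d i.
Proof. by move=> rb; apply: x_ge0; case: (policy_opt d rb). Qed.

(* Raising the own bid to [b_i + 1 > 0] first, monotonicity bounds the allocation
   by the optimal welfare at the raised bids even when [r = 0]. *)
Lemma implied_rule_bounded b d i : bid_vectors r b -> exists C,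
  forall b', bid_vectors r b' -> (forall j, tnth b' j <= tnth b j) ->
  implied_rule x policy b' d i <= C.
Proof.
move=> rb; set m := tnth b i + 1; set B := set_bid b i m.
have rm : r <= m by rewrite (le_trans (rb i))// lerDl.
have m0 : 0 < m by rewrite ltr_wpDl// (le_trans r_ge0).
have rB : bid_vectors r B by exact: bid_vectors_set_bid.
exists ((\sum_(j < n) tnth B j * x (policy B d) d j) / m) => b' rb' le'.
set b2 := set_bid b' i m.
have rb2 : bid_vectors r b2 by exact: bid_vectors_set_bid.
have [D2 _] := policy_opt d rb2; have [_ optB] := policy_opt d rB.
apply: (@le_trans _ _ (implied_rule x policy b2 d i)).
  apply: implied_rule_monotone => //.
    by move=> j ji; rewrite tnth_set_bid (negPf ji).
  by rewrite tnth_set_bid eqxx (le_lt_trans (le' i))// ltrDl.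
(* The policy chosen at [b2] competes at the bids [B]: its welfare there is at most the optimum, and
   at least the term of buyer [i], the other terms being nonnegative. *)
rewrite ler_pdivlMr// mulrC; apply: le_trans (optB _ D2).
rewrite (bigD1 i)//= {1}/B tnth_set_bid eqxx lerDl.
apply: sumr_ge0 => j ji; apply: mulr_ge0; last exact: x_ge0.
by rewrite (le_trans r_ge0).
Qed.

End ImpliedRule.

Theorem lemma5p6 (R : realType) (n : nat) (D S : Type) (Delta : set S)
    (x : S -> n.-tuple D -> 'I_n -> R)
    (x_ge0 : forall rho, Delta rho -> forall d i, 0 <= x rho d i)
    (mu r : R) (mu_gt0 : 0 < mu) (mu_lt1 : mu < 1) (r_ge0 : 0 <= r)
    (policy : n.-tuple R -> n.-tuple D -> S)
    (policy_opt : forall b d, bid_vectors r b ->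
       argmax Delta (fun rho => \sum_(i < n) tnth b i * x rho d i) (policy b d)) :
  ex_post_monotone r (implied_rule x policy) /\
  ((forall d i,
      measurable_fun (bid_vectors r)
        (fun b : n.-tuple R => implied_rule x policy b d i)) ->
   forall (dT : measure_display) (T : measurableType dT) (P : probability T R)
     (c : 'I_n -> {RV P >-> bool}) (g : 'I_n -> {RV P >-> R}),
     bks_coins mu c g ->
     truthful_in_expectation P r
       (bks_mechanism mu r c g (implied_rule x policy))).
Proof.
split; first exact: implied_rule_monotone policy_opt.
move=> A_meas dT T P c g coins; apply: bks_truthful => //.
- exact: implied_rule_monotone policy_opt.
- by move=> b d i; exact: implied_rule_ge0 policy_opt x_ge0 _ _ _.
- by move=> b d i; exact: implied_rule_bounded policy_opt r_ge0 x_ge0 _ _ _.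
Qed.
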